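(* The family $\{\chi_r-(r-1)^{1/2}:\ r\in[1,\infty)\}$, indexed by real $r\ge1$ with the usual order, is stochastically monotone; that is, for all real $1\le r\le d$ and all $t\in\mathbb R$ $$\mathbf P\bigl(\chi_r-(r-1)^{1/2}\ge t\bigr)\ge\mathbf P\bigl(\chi_d-(d-1)^{1/2}\ge t\bigr).$$
   Context: For real $r\ge1$, $\chi_r$ is a random variable with density $p_r(u)=C_ru^{r-1}e^{-u^2/2}I\{u>0\}$ on $\mathbb R$, where $C_r$ is the normalizing constant. *)

(* Defs.v *)
From HB Require Import structures.
From mathcomp Require Import all_boot all_order all_algebra.
From mathcomp Require Import all_classical all_reals all_analysis.

Set Implicit Arguments.
Unset Strict Implicit.
Unset Printing Implicit Defensive.

Import Order.TTheory GRing.Theory Num.Theory.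
Import numFieldNormedType.Exports.

Local Open Scope classical_set_scope.
Local Open Scope ring_scope.

Definition chi_weight (R : realType) (r u : R) : R :=
  u `^ (r - 1) * expR (- (u ^+ 2 / 2)) * \1_[set v : R | 0 < v] u.

Definition chi_const (R : realType) (r : R) : R :=
  (\int[lebesgue_measure]_u chi_weight r u)^-1.

Definition chi_pdf (R : realType) (r u : R) : R := chi_const r * chi_weight r u.

Definition has_density (R : realType) (d : measure_display)
    (T : measurableType d) (P : probability T R) (X : {RV P >-> R})
    (p : R -> R) : Prop :=
  forall A : set R, measurable A ->
    distribution P X A = (\int[lebesgue_measure]_(u in A) (p u)%:E)%E.

(* Only the laws of the X r matter, so each X r may live on its own probability
   space. "Monotone" means stochastically decreasing in the index. *)
Definition stochastically_monotone (R : realType) (D : set R)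
    (disp : R -> measure_display) (T : forall r, measurableType (disp r))
    (P : forall r, probability (T r) R) (X : forall r, T r -> R) : Prop :=
  forall r d : R, D r -> D d -> r <= d -> forall t : R,
    (P r [set w | (t <= X r w)%R] >= P d [set w | (t <= X d w)%R])%E.

(* Main.v *)
Require Import Defs.
From HB Require Import structures.
From mathcomp Require Import all_boot all_order all_algebra.
From mathcomp Require Import all_classical all_reals all_analysis.
From mathcomp Require Import measurable_realfun ring lra.

Set Implicit Arguments.
Unset Strict Implicit.
Unset Printing Implicit Defensive.

Import Order.TTheory GRing.Theory Num.Theory.
Import numFieldNormedType.Exports.

Local Open Scope classical_set_scope.
Local Open Scope ring_scope.

(** The statement says that Y_r = chi_r - sqrt (r - 1) decreases stochastically
    in r, and it holds because the family is ordered in the stronger sense of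
    the likelihood ratio. Write a = sqrt (r - 1), which for r > 1 is the mode of
    chi_r. For t > - a the logarithm of the density of Y_r at t is
      a^2 ln (t + a) - (t + a)^2 / 2 + constant,
    with derivative a^2 / (t + a) - (t + a). For 0 <= a <= b, the log-ratio of
    the densities with parameters b and a thus has derivative
      - (b - a) t^2 / ((t + a) (t + b)) <= 0
    to the right of - a: the centring at the mode is what turns the numerator
    into a square. Between - b and - a only the density with parameter a
    vanishes, so the ratio counts as infinite there, and it is nonincreasing
    wherever it makes sense. Cross-multiplied to avoid division by zero, this is
    [chi_pdf_mlr], in which the normalizing constants enter both sides as the
    same nonnegative factor.

    A monotone likelihood ratio gives the comparison of tails: integrating
    g(y) f(x) <= g(x) f(y) over x < t <= y yields
      F(< t) G(>= t) <= G(< t) F(>= t),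
    and as both laws have total mass 1 this reads G(>= t) <= F(>= t)
    ([mlr_tail_le]).

    The rest is the passage from the law of chi_r to that of chi_r - a, that is,
    the translation invariance of the Lebesgue measure. *)

(** * Translations of the Lebesgue measure *)

(** The carrier is [measurableTypeR R], not [R], because that is the type on
    which the Lebesgue measure is defined; the pushforward of the measure along
    a translation is then itself a measure. *)
Definition translation (R : realType) (a : R) (x : measurableTypeR R) :
  measurableTypeR R := x + a.

Lemma measurable_translation (R : realType) (a : R) :
  measurable_fun [set: measurableTypeR R] (translation a).
Proof. exact: measurable_funD. Qed.

HB.instance Definition _ (R : realType) (a : R) :=
  isMeasurableFun.Build _ _ _ _ (translation a) (measurable_translation a).

(** A measure that agrees with the Lebesgue measure on half-open intervals
    equals it, and translating an interval preserves its length. *)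
Lemma lebesgue_measure_shift (R : realType) (a : R) (A : set R) :
  measurable A ->
  lebesgue_measure A = lebesgue_measure [set x : R | A (x + a)].
Proof.
move=> mA.
apply: (lebesgue_measure_unique
          (mu := pushforward lebesgue_measure (translation a))) mA.
move=> _ [[u v] _ <-] /=.
rewrite /pushforward (_ : _ @^-1` _ = `]u - a, v - a]%classic); last first.
  by apply/seteqP; split=> x /=; rewrite !in_itv/= ltrBlDr lerBrDr.
by rewrite !lebesgue_measure_itv/= !lte_fin ltrD2r -!EFinB opprB addrA subrK.
Qed.

Lemma ge0_integral_shift (R : realType) (a : R) (D : set R) (f : R -> \bar R) :
  measurable D -> measurable_fun D f -> (forall x, D x -> (0 <= f x)%E) ->
  (\int[lebesgue_measure]_(x in [set x : R | D (x + a)%R]) f (x + a)%R =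
   \int[lebesgue_measure]_(x in D) f x)%E.
Proof.
move=> mD mf f0.
transitivity
  (\int[pushforward lebesgue_measure (translation a)]_(x in D) f x)%E.
  rewrite (ge0_integral_pushforward (measurable_translation a))// => y /set_mem.
  exact: f0.
apply: eq_measure_integral => A mA _.
exact: (esym (lebesgue_measure_shift a mA)).
Qed.

Lemma probability_shiftE (R : realType) (d : measure_display)
    (T : measurableType d) (P : probability T R) (X : {RV P >-> R})
    (p : R -> R) (a : R) (D : set R) :
  measurable_fun [set: R] p -> (forall u, 0 <= p u) -> has_density X p ->
  measurable D ->
  P [set w | D (X w - a)] =
  (\int[lebesgue_measure]_(x in D) (p (x + a)%R)%:E)%E.
Proof.
move=> mp p0 Xp mD.
pose E : set R := [set u | D (u - a)].
have mE : measurable E.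
  rewrite -[E]setTI.
  apply: (_ : measurable_fun setT (fun u : R => u - a)) => //.
  exact: measurable_funB.
rewrite (_ : D = [set x | E (x + a)]); last first.
  by apply/funext => x; rewrite /E/= addrK.
rewrite (@ge0_integral_shift R a E (fun u => (p u)%:E))//; last 2 first.
  by apply/measurable_EFinP; exact: measurable_funTS.
  by move=> u _; rewrite lee_fin.
rewrite -Xp// /distribution /pushforward /E/=; congr (P _).
by apply/seteqP; split=> w /=; rewrite addrK.
Qed.

(** * The chi densities *)

Lemma measurable_chi_pdf (R : realType) (r : R) :
  measurable_fun [set: R] (chi_pdf r).
Proof.
apply: measurable_funM => //; apply: measurable_funM.
  apply: measurable_funM.
    exact: measurable_powR.
  apply: measurableT_comp => //; apply: measurableT_comp => //.
  by apply: measurable_funM => //; exact: exprn_measurable.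
apply: measurable_indic; rewrite (_ : [set _ | _] = `]0, +oo[%classic) //.
by apply/seteqP; split=> x /=; rewrite in_itv/= andbT.
Qed.

Lemma chi_weight_ge0 (R : realType) (r u : R) : 0 <= chi_weight r u.
Proof. by rewrite !mulr_ge0 ?powR_ge0 ?expR_ge0. Qed.

Lemma chi_pdf_ge0 (R : realType) (r u : R) : 0 <= chi_pdf r u.
Proof.
rewrite mulr_ge0 ?chi_weight_ge0// invr_ge0 Rintegral_ge0// => x _.
exact: chi_weight_ge0.
Qed.

Lemma chi_weight_gt0E (R : realType) (r u : R) : 0 < u ->
  chi_weight r u = expR ((r - 1) * ln u - u ^+ 2 / 2).
Proof.
move=> u0; rewrite /chi_weight indicE mem_set// mulr1 /powR gt_eqF//.
by rewrite expRD.
Qed.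

Lemma chi_weight_le0E (R : realType) (r u : R) : u <= 0 ->
  chi_weight r u = 0.
Proof.
by move=> u0; rewrite /chi_weight indicE memNset ?mulr0//= ltNge u0.
Qed.

(** * Monotone likelihood ratio of the centred chi laws *)

Lemma is_derive_chi_log (R : realType) (c t : R) : 0 < t + c ->
  is_derive t 1 (fun s : R => c ^+ 2 * ln (s + c) - (s + c) ^+ 2 / 2)
    (c ^+ 2 / (t + c) - (t + c)).
Proof.
move=> tc.
have Dshift : is_derive t 1 (fun s : R => s + c) 1.
  apply: (is_derive_eq
            (is_deriveD (is_derive_id t 1) (is_derive_cst c t 1))).
  by rewrite addr0.
have Dln := @is_derive1_comp R (@ln R) (fun s => s + c) t _ _
  (is_derive1_ln tc) Dshift.
have Dsq := is_deriveM Dshift Dshift.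
have Dhalf := is_derive_cst (2^-1 : R) t 1.
apply: (is_derive_eq
          (is_deriveB (is_deriveZ (c ^+ 2) Dln) (is_deriveM Dsq Dhalf))).
by rewrite /= /GRing.scale/= /cst; field; rewrite gt_eqF.
Qed.

(** The derivative of c^2 / (t + c) - (t + c) in c is - t^2 / (t + c)^2 <= 0:
    in its numerator 2 c (t + c) - c^2 - (t + c)^2 the terms of degree 0 and 1
    in t cancel. The difference between the values at c = b and c = a is the
    function [dF] of the proof. *)
Lemma chi_log_ratio_nincr (R : realType) (a b x y : R) :
  0 <= a -> a <= b -> 0 < x + a -> x <= y ->
  b ^+ 2 * ln (y + b) - (y + b) ^+ 2 / 2
    - (a ^+ 2 * ln (y + a) - (y + a) ^+ 2 / 2) <=
  b ^+ 2 * ln (x + b) - (x + b) ^+ 2 / 2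
    - (a ^+ 2 * ln (x + a) - (x + a) ^+ 2 / 2).
Proof.
move=> a0 ab xa xy.
pose F (t : R) := b ^+ 2 * ln (t + b) - (t + b) ^+ 2 / 2
    - (a ^+ 2 * ln (t + a) - (t + a) ^+ 2 / 2).
pose dF (t : R) := - ((b - a) * t ^+ 2 / ((t + a) * (t + b))).
have pos t : x <= t -> (0 < t + a) * (0 < t + b) by move=> xt; split; lra.
have FdF t : x <= t -> is_derive t 1 F (dF t).
  move=> /pos[ta tb].
  apply: (is_derive_eq
            (is_deriveB (is_derive_chi_log tb) (is_derive_chi_log ta))).
  by rewrite /dF; field; rewrite !gt_eqF.
have [||z] := @MVT_segment R F dF x y xy.
- by move=> t /itvP tI; apply: FdF; rewrite tI.
- apply: continuous_in_subspaceT => t /set_mem/= /itvP tI.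
  apply/differentiable_continuous/derivable1_diffP.
  have dFt : is_derive t 1 F (dF t) by apply: FdF; rewrite tI.
  exact: ex_derive.
rewrite in_itv/= => /andP[/pos[za zb] _] FE.
rewrite -subr_le0 -/(F x) -/(F y) FE mulNr oppr_le0.
apply: mulr_ge0; last by rewrite subr_ge0.
by apply: divr_ge0; apply: mulr_ge0; rewrite ?sqr_ge0 ?subr_ge0// ltW.
Qed.

(** The product form covers the region x <= - sqrt (r - 1), where the density
    with index r vanishes and the ratio has no meaning. Elsewhere all four
    arguments are positive and the inequality is the exponential of
    [chi_log_ratio_nincr]. *)
Lemma chi_pdf_mlr (R : realType) (r d x y : R) :
  1 <= r -> r <= d -> x <= y ->
  chi_pdf d (y + Num.sqrt (d - 1)) * chi_pdf r (x + Num.sqrt (r - 1)) <=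
  chi_pdf d (x + Num.sqrt (d - 1)) * chi_pdf r (y + Num.sqrt (r - 1)).
Proof.
move=> r1 rd xy.
set a := Num.sqrt (r - 1); set b := Num.sqrt (d - 1).
have a0 : 0 <= a by exact: sqrtr_ge0.
have ab : a <= b by rewrite ler_sqrt; lra.
have a2 : r - 1 = a ^+ 2 by rewrite sqr_sqrtr//; lra.
have b2 : d - 1 = b ^+ 2 by rewrite sqr_sqrtr//; lra.
have [xa|xa] := leP (x + a) 0.
  by rewrite {2}/chi_pdf chi_weight_le0E// !mulr0 mulr_ge0 ?chi_pdf_ge0.
rewrite /chi_pdf mulrACA [leRHS]mulrACA ler_wpM2l//.
  by rewrite mulr_ge0// invr_ge0 Rintegral_ge0// => u _; exact: chi_weight_ge0.
rewrite !chi_weight_gt0E; [|lra..].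
rewrite -!expRD ler_expR a2 b2.
have := chi_log_ratio_nincr a0 ab xa xy; lra.
Qed.

(** * From likelihood ratios to tails *)

(** The hypothesis is integrated over x < t and then over y >= t, one variable
    at a time, the other factors being constants. The total masses 1 turn the resulting (1 - F) G <= (1 - G) F, for
    the tails F and G of f and g, into G <= F. *)
Lemma mlr_tail_le (R : realType)
    (mu : {measure set (measurableTypeR R) -> \bar R}) (f g : R -> R) (t : R) :
  measurable_fun [set: R] f -> measurable_fun [set: R] g ->
  (forall x, 0 <= f x) -> (forall x, 0 <= g x) ->
  (\int[mu]_x (f x)%:E = 1)%E -> (\int[mu]_x (g x)%:E = 1)%E ->
  (forall x y, x <= y -> g y * f x <= g x * f y) ->
  (\int[mu]_(x in `[t, +oo[) (g x)%:E <= \int[mu]_(x in `[t, +oo[) (f x)%:E)%E.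
Proof.
move=> mf mg f0 g0 If Ig fg.
pose L : set (measurableTypeR R) := `]-oo, t[%classic.
pose U : set (measurableTypeR R) := `[t, +oo[%classic.
have mL : measurable L by exact: measurable_itv.
have mU : measurable U by exact: measurable_itv.
have mE (h : R -> R) (D : set (measurableTypeR R)) :
    measurable_fun [set: R] h -> measurable_fun D (fun x => (h x)%:E).
  by move=> mh; apply/measurable_EFinP; apply: measurable_funTS.
have I0 (h : R -> R) (D : set (measurableTypeR R)) : (forall x, 0 <= h x) ->
    (0 <= \int[mu]_(x in D) (h x)%:E)%E.
  by move=> h0; apply: integral_ge0 => x _; rewrite lee_fin.
have split (h : R -> R) : measurable_fun [set: R] h -> (forall x, 0 <= h x) ->
    (\int[mu]_x (h x)%:E = 1)%E ->
    (\int[mu]_(x in L) (h x)%:E + \int[mu]_(x in U) (h x)%:E = 1)%E.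
  move=> mh h0 <-.
  have LU : L `|` U = setT.
    apply/seteqP; split=> x //= _.
    by rewrite /L /U/= !in_itv/= andbT; case: (ltP x t); [left|right].
  rewrite -LU ge0_integral_setU//; first exact: mE.
    by move=> x _; rewrite lee_fin.
  apply/disj_setPS => x []; rewrite /L /U/= !in_itv/= andbT => xt.
  by rewrite leNgt xt.
have ZL (h : R -> R) (D : set (measurableTypeR R)) (k : \bar R) :
    measurable D -> measurable_fun [set: R] h -> (forall x, 0 <= h x) ->
    (0 <= k)%E ->
    (\int[mu]_(x in D) (k * (h x)%:E) = k * \int[mu]_(x in D) (h x)%:E)%E.
  move=> mD mh h0 k0; rewrite ge0_integralZl//; first exact: mE.
  by move=> x _; rewrite lee_fin.
have cross : (\int[mu]_(x in L) (f x)%:E * \int[mu]_(y in U) (g y)%:E <=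
              \int[mu]_(x in L) (g x)%:E * \int[mu]_(y in U) (f y)%:E)%E.
  rewrite -!ZL ?I0//; apply: ge0_le_integral => //.
  - by move=> y _; rewrite mule_ge0 ?lee_fin ?I0.
  - by apply: measurable_funeM; exact: mE.
  - by apply: measurable_funeM; exact: mE.
  move=> y; rewrite /U/= in_itv/= andbT => ty.
  rewrite muleC [leRHS]muleC -!ZL ?lee_fin//; apply: ge0_le_integral => //.
  - by move=> x _; rewrite mule_ge0 ?lee_fin.
  - by apply: measurable_funeM; exact: mE.
  - by apply: measurable_funeM; exact: mE.
  move=> x; rewrite /L/= in_itv/= => xt.
  by rewrite -!EFinM lee_fin [leRHS]mulrC fg// ltW// (lt_le_trans xt).
(* Total mass 1 makes both parts finite, so that the rest is arithmetic in R. *)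
have fin (u v : \bar R) : (0 <= u)%E -> (0 <= v)%E -> (u + v = 1)%E ->
    exists s, u = (1 - s)%:E /\ v = s%:E.
  by case: u v => [u| |] [v| |]//= _ _ [<-]; exists v; rewrite addrK.
have [F [FL FU]] := fin _ _ (I0 f L f0) (I0 f U f0) (split f mf f0 If).
have [G [GL GU]] := fin _ _ (I0 g L g0) (I0 g U g0) (split g mg g0 Ig).
move: cross; rewrite -/U FL FU GL GU -!EFinM !lee_fin; lra.
Qed.

Theorem corollary5p5 (R : realType) (disp : R -> measure_display)
    (T : forall r : R, measurableType (disp r))
    (P : forall r : R, probability (T r) R)
    (chi : forall r : R, {RV (P r) >-> R})
    (chi_density : forall r : R, 1 <= r -> has_density (chi r) (chi_pdf r)) :
  stochastically_monotone [set r : R | 1 <= r] P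
    (fun r w => chi r w - Num.sqrt (r - 1)).
Proof.
move=> r d /= r1 d1 rd t.
pose q (c : R) (x : R) : R := chi_pdf c (x + Num.sqrt (c - 1)).
have mq c : measurable_fun [set: R] (q c).
  apply: (measurableT_comp (measurable_chi_pdf c)); exact: measurable_funD.
have q0 c x : 0 <= q c x by exact: chi_pdf_ge0.
have Pq c (D : set R) : 1 <= c -> measurable D ->
    P c [set w | D (chi c w - Num.sqrt (c - 1))] =
    (\int[lebesgue_measure]_(x in D) (q c x)%:E)%E.
  move=> c1 mD; apply: probability_shiftE (chi_density c c1) mD.
  - exact: measurable_chi_pdf.
  - exact: chi_pdf_ge0.
(* The total mass is read off from the law of chi, not from the constant C_c. *)
have q1 c : 1 <= c -> (\int[lebesgue_measure]_x (q c x)%:E = 1)%E.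
  move=> c1; rewrite -Pq//; exact: probability_setT.
have tailE c : [set w | t <= chi c w - Num.sqrt (c - 1)] =
    [set w | `[t, +oo[%classic (chi c w - Num.sqrt (c - 1))].
  by apply/seteqP; split=> w /=; rewrite in_itv/= andbT.
rewrite !tailE !Pq//.
apply: mlr_tail_le => //; [exact: q1|exact: q1|].
by move=> x y xy; exact: chi_pdf_mlr.
Qed.
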